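(* Let $p>2$ be prime, $S$ a free profinite group, $N$ a closed normal subgroup of $S$ contained in $S^{(2,p)}$, and $G=S/N$. Then $T^{\mathbb{Z}/p^2}(G)\cap T^{M_{p^3}}(G)=G^{(3,p)}$ if and only if $G$ satisfies the Bockstein-cup kernel condition: the kernel of $\inf\colon H^2(G/G^{(2,p)})\to H^2(G)$ is generated by those of its elements that are of the form $\operatorname{Bock}(\varphi)+\varphi\cup\psi$ with $\varphi,\psi\in H^1(G/G^{(2,p)})$.
   Context: For profinite groups $\mathbb{U}$ and $G$, $T^{\mathbb{U}}(G)$ denotes the intersection of the kernels of all continuous homomorphisms $G\to\mathbb{U}$. $M_{p^3}=\langle r,s\mid r^{p^2}=s^p=1,\ [r,s]=r^p\rangle$ is the extra-special group of order $p^3$ and exponent $p^2$. Cohomology is $H^i(\cdot)=H^i(\cdot,\mathbb{Z}/p)$ with trivial action; $\operatorname{Bock}$ is the Bockstein homomorphism $H^1\to H^2$, i.e. the connecting map for $0\to\mathbb{Z}/p\to\mathbb{Z}/p^2\to\mathbb{Z}/p\to0$. The lower $p$-central filtration is $G^{(1,p)}=G$, $G^{(k+1,p)}=(G^{(k,p)})^p[G,G^{(k,p)}]$ (closed subgroups generated). *)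

(* Defs.v *)
From mathcomp Require Import all_boot all_algebra all_fingroup all_solvable.
From mathcomp Require Import all_classical topology.

Set Implicit Arguments.
Unset Strict Implicit.
Unset Printing Implicit Defensive.

Import GRing.Theory.
Local Open Scope classical_set_scope.

Record ProfiniteGroup := ProfGroup {
  pg_sort :> topologicalType;
  pg_mul : pg_sort -> pg_sort -> pg_sort;
  pg_inv : pg_sort -> pg_sort;
  pg_one : pg_sort;
  pg_mulA : forall x y z, pg_mul x (pg_mul y z) = pg_mul (pg_mul x y) z;
  pg_mul1 : forall x, pg_mul pg_one x = x;
  pg_mulV : forall x, pg_mul (pg_inv x) x = pg_one;
  pg_mul_cont : continuous (fun xy : pg_sort * pg_sort => pg_mul xy.1 xy.2);
  pg_inv_cont : continuous pg_inv;
  pg_compact : compact [set: pg_sort];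
  pg_hausdorff : hausdorff_space pg_sort;
  pg_tdisc : totally_disconnected [set: pg_sort]
}.

Arguments pg_mul {_}. Arguments pg_inv {_}. Arguments pg_one {_}.

Definition pg_pow (G : ProfiniteGroup) (x : G) (n : nat) : G :=
  iter n (pg_mul x) pg_one.

Definition pg_comm (G : ProfiniteGroup) (x y : G) : G :=
  pg_mul (pg_mul (pg_inv x) (pg_inv y)) (pg_mul x y).

Definition is_subgroup (G : ProfiniteGroup) (H : set G) : Prop :=
  H pg_one /\ (forall x y, H x -> H y -> H (pg_mul x y)) /\
  (forall x, H x -> H (pg_inv x)).

Definition closed_gen (G : ProfiniteGroup) (A : set G) : set G :=
  \bigcap_(H in [set H : set G | is_subgroup H /\ closed H /\ A `<=` H]) H.

Definition lpc_step (G : ProfiniteGroup) (p : nat) (H : set G) : set G :=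
  closed_gen ([set pg_pow x p | x in H] `|`
              [set z | exists g h, H h /\ z = pg_comm g h]).

(* lower p-central filtration, indexed from 1: lpc G p 1 = G,
   lpc G p k.+1 = (lpc G p k)^p [G, lpc G p k].  (lpc G p 0 = G as junk.) *)
Definition lpc (G : ProfiniteGroup) (p : nat) (k : nat) : set G :=
  iter k.-1 (@lpc_step G p) [set: G].
Arguments lpc : clear implicits.

Definition cont_hom (G H : ProfiniteGroup) (f : G -> H) : Prop :=
  (forall x y, f (pg_mul x y) = pg_mul (f x) (f y)) /\ continuous f.

Definition cont_hom_fin (G : ProfiniteGroup) (gT : finGroupType) (f : G -> gT)
  : Prop :=
  (forall x y, f (pg_mul x y) = (f x * f y)%g) /\
  (forall u : gT, open (f @^-1` [set u])).

Definition T_of (gT : finGroupType) (G : ProfiniteGroup) : set G :=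
  [set g | forall f : G -> gT, cont_hom_fin f -> f g = 1%g].

Definition is_free_profinite (S : ProfiniteGroup) : Prop :=
  exists (X : Type) (iota : X -> S),
    (forall U : set S, open U -> U pg_one -> finite_set [set x | ~ U (iota x)]) /\
    (forall (gT : finGroupType) (f : X -> gT),
        finite_set [set x | f x <> 1%g] ->
        exists! phi : S -> gT, cont_hom_fin phi /\ forall x, phi (iota x) = f x).

(* Continuous cohomology with coefficients Z/p, trivial action, via     *)
(* inhomogeneous cochains.  Cochains on G/G^(2,p) are identified with   *)
(* cochains on G constant on G^(2,p)-cosets; inflation is then the      *)
(* identity on cochains.                                                *)
Section Cohomology.
Local Open Scope ring_scope.
Variables (G : ProfiniteGroup) (p : nat).

Definition Phi : set G := lpc G p 2.

Definition cont1 (f : G -> 'Z_p) : Prop := forall z, open (f @^-1` [set z]).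
Definition cont2 (c : G -> G -> 'Z_p) : Prop :=
  forall z, open [set xy : G * G | c xy.1 xy.2 = z].

Definition infl1 (f : G -> 'Z_p) : Prop :=
  forall x u, Phi u -> f (pg_mul x u) = f x.
Definition infl2 (c : G -> G -> 'Z_p) : Prop :=
  forall x y u v, Phi u -> Phi v -> c (pg_mul x u) (pg_mul y v) = c x y.

Definition delta1 (f : G -> 'Z_p) : G -> G -> 'Z_p :=
  fun x y => f y - f (pg_mul x y) + f x.

Definition cocycle2 (c : G -> G -> 'Z_p) : Prop :=
  forall x y z, c y z - c (pg_mul x y) z + c x (pg_mul y z) - c x y = 0.

Definition Z2_quot (c : G -> G -> 'Z_p) : Prop :=
  cont2 c /\ infl2 c /\ cocycle2 c.

Definition B2_quot (c : G -> G -> 'Z_p) : Prop :=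
  exists f, cont1 f /\ infl1 f /\ forall x y, c x y = delta1 f x y.

Definition B2 (c : G -> G -> 'Z_p) : Prop :=
  exists f, cont1 f /\ forall x y, c x y = delta1 f x y.

Definition ker_inf (c : G -> G -> 'Z_p) : Prop := Z2_quot c /\ B2 c.

Definition H1_quot (f : G -> 'Z_p) : Prop :=
  cont1 f /\ infl1 f /\ forall x y, f (pg_mul x y) = f x + f y.

(* Bockstein: connecting map for 0 -> Z/p -> Z/p^2 -> Z/p -> 0, computed on
   the lift of f with values in {0,..,p-1}: (f~ x + f~ y - f~(xy)) / p. *)
Definition bock (f : G -> 'Z_p) : G -> G -> 'Z_p :=
  fun x y => (((f x : nat) + (f y : nat)) %/ p)%:R.

Definition cup (f g : G -> 'Z_p) : G -> G -> 'Z_p := fun x y => f x * g y.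

Definition bock_cup_form (c : G -> G -> 'Z_p) : Prop :=
  exists f g, H1_quot f /\ H1_quot g /\
    forall x y, c x y = bock f x y + cup f g x y.

Definition bockstein_cup_kernel_condition : Prop :=
  forall c, ker_inf c ->
    exists (n : nat) (e : 'I_n -> G -> G -> 'Z_p) (a : 'I_n -> 'Z_p),
      (forall i, ker_inf (e i) /\ bock_cup_form (e i)) /\
      B2_quot (fun x y => c x y - \sum_(i < n) a i * e i x y).

End Cohomology.

Arguments T_of : clear implicits.
Arguments bockstein_cup_kernel_condition : clear implicits.

(* Main.v *)
(** Let [Phi = G^(2,p)]. If an inflated 2-cocycle is a coboundary [delta1 f] on [G], then [f - f 1]
    restricts to a homomorphism [Phi -> Z/p] which kills [G^(3,p)], and it vanishes exactly when
    the cocycle is already a coboundary on [G/Phi]; every continuous homomorphism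
    [Phi/G^(3,p) -> Z/p] arises in this way. Homomorphisms from [G] to
    [Mod_(p^3) = {y^j x^i}] are the same as triples [(phi, psi, f)] with
    [Bock phi + phi cup psi = delta1 f], and such a homomorphism restricts to [Phi] as
    [x^(- p f)]. So [T^(Mod_(p^3))(G)] is the common kernel on [Phi] of the homomorphisms
    attached to the Bockstein-cup elements of [ker inf]. By compactness and duality this common
    kernel is [G^(3,p)] if and only if these elements span [ker inf]. Since [Z/p^2] embeds in
    [Mod_(p^3)], the first kernel contributes nothing. *)
From HB Require Import structures.
Require Import Defs.
From mathcomp Require Import all_boot all_algebra all_fingroup all_solvable.
From mathcomp Require Import all_classical topology.
From mathcomp Require Import ring.
Import GRing.Theory.
Local Open Scope classical_set_scope.

(** * Compact totally disconnected spaces *)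

Section ZeroDimensional.
Variable T : topologicalType.

(** If every clopen neighbourhood of [x] met [C], their traces on [C] would generate a proper
    filter; a cluster point [y] of it in [C] contradicts the clopen set separating [x] from [y]. *)
Lemma clopen_avoid (C : set T) (x : T) : compact C ->
  (forall y, C y -> exists K, [/\ clopen K, K x & ~ K y]) ->
  exists K, [/\ clopen K, K x & K `<=` ~` C].
Proof.
move=> cC sepC; apply: contrapT => noK.
pose F := filter_from [set K : set T | clopen K /\ K x] (fun K => K `&` C).
have FF : Filter F.
  apply: filter_from_filter; first by exists setT; split=> //; exact: clopenT.
  move=> A B [cA Ax] [cB Bx]; exists (A `&` B); first by split=> //; exact: clopenI.
  by move=> y [[? ?] ?].
have PF : ProperFilter F.
  apply: filter_from_proper => A [cA Ax]; apply: contrapT => noy; apply: noK.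
  by exists A; split=> // y Ay Cy; apply: noy; exists y.
have FC : F C by exists setT; [split=> //; exact: clopenT|move=> y []].
have [y [Cy clFy]] := cC F PF FC; have [K [[oK cK] Kx nKy]] := sepC y Cy.
have [||z [[Kz _] //]] := clFy (K `&` C) (~` K); first by exists K.
by apply: open_nbhs_nbhs; split=> //; exact: closed_openC.
Qed.

(* The quasi-component of [x], the intersection of its clopen neighbourhoods, is connected. *)
Lemma compact_tdisc_zero_dimensional : compact [set: T] -> hausdorff_space T ->
  totally_disconnected [set: T] -> zero_dimensional T.
Proof.
move=> cT hT tdT x y xny; apply: contrapT => nosep.
pose Q := [set z | forall K, clopen K -> K x -> K z].
have Qx : Q x by [].
have cQ : closed Q.
  have -> : Q = \bigcap_(K in [set K : set T | clopen K /\ K x]) K.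
    by apply/seteqP; split=> z Qz K; [case; exact: Qz|move=> ? ?; exact: Qz].
  by apply: closed_bigI => K [[]].
(* The quasi-component does not split: of two disjoint closed sets covering it, the one without [x]
   is empty. *)
have splitQ A A' : closed A -> closed A' -> Q `<=` A `|` A' -> A' `<=` Q ->
    A `<=` ~` A' -> A x -> A' = set0.
  move=> cA cA' QAA' A'Q dAA' Ax.
  have nA : set_nbhs A (~` A').
    by apply/set_nbhsP; exists (~` A'); split=> //; exact: closed_openC.
  have [U /set_nbhsP[W [oW AW WU]] cUA'] := compact_normal hT cT cA nA.
  have cWA' : closure W `<=` ~` A' by apply: subset_trans cUA'; exact: closureS.
  have cC : closed (closure W `&` ~` W).
    by apply: closedI; [exact: closed_closure|exact: open_closedC].
  have [|z [cWz nWz]|K [clK Kx KC]] := @clopen_avoid (closure W `&` ~` W) x.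
  - exact: subclosed_compact cC cT (fun _ _ => I).
  - apply: contrapT => noK; have Qz : Q z.
      by move=> K clK Kx; apply: contrapT => nKz; apply: noK; exists K.
    by case: (QAA' _ Qz) => [/AW //|]; exact: cWA'.
  (* [K] misses the boundary of [W], so its traces on [W] and on the closure of [W] agree; this
     clopen set contains [x], hence all of [Q]. *)
  have KW : K `&` W = K `&` closure W.
    apply/seteqP; split=> z [Kz Wz]; split=> //; first exact: subset_closure.
    by apply: contrapT => nWz; exact: (KC z).
  have clKW : clopen (K `&` W).
    split; first by apply: openI => //; exact: clK.1.
    by rewrite KW; apply: closedI; [exact: clK.2|exact: closed_closure].
  apply/seteqP; split=> // z A'z; have [_ Wz] := A'Q _ A'z _ clKW (conj Kx (AW _ Ax)).
  by apply: (cWA' z) => //; exact: subset_closure.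
have connQ : connected Q.
  move=> B [b Bb] [C oC BC] [D cD BD].
  have cB : closed B by rewrite BD; exact: closedI.
  have cB' : closed (Q `&` ~` C) by apply: closedI => //; exact: open_closedC.
  have BQ : B `<=` Q by rewrite BC => z [].
  have cover : Q `<=` B `|` (Q `&` ~` C).
    by move=> z Qz; case: (pselect (C z)) => Cz; [left; rewrite BC|right].
  have disj : B `<=` ~` (Q `&` ~` C) by rewrite BC => z [_ Cz] [].
  case: (cover _ Qx) => [Bx|B'x].
    have e := splitQ _ _ cB cB' cover (fun z => @proj1 _ _) disj Bx.
    by apply/seteqP; split=> // z /cover[//|]; rewrite e.
  have e : B = set0.
    by apply: splitQ cB' cB _ BQ _ B'x => [z /cover[|]|z + Bz]; [right|left|exact: disj].
  by move: Bb; rewrite e.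
have : connected_component [set: T] x y.
  exists Q; first by split.
  by move=> K clK Kx; apply: contrapT => nKy; apply: nosep; exists K.
by rewrite tdT // => e; move: xny; rewrite e eqxx.
Qed.

End ZeroDimensional.

(** * Profinite groups *)

Local Notation "x ** y" := (pg_mul x y) (at level 40, left associativity).

Section PgTheory.
Variable G : ProfiniteGroup.
Implicit Types x y z : G.

Lemma pgK x y : pg_inv x ** (x ** y) = y.
Proof. by rewrite pg_mulA pg_mulV pg_mul1. Qed.

Lemma pg_mulI x y z : x ** y = x ** z -> y = z.
Proof. by move=> e; rewrite -(pgK x y) e pgK. Qed.

Lemma pgm1 x : x ** pg_one = x.
Proof. by apply: (@pg_mulI (pg_inv x)); rewrite pgK pg_mulV. Qed.

Lemma pgmV x : x ** pg_inv x = pg_one.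
Proof. by apply: (@pg_mulI (pg_inv x)); rewrite pgK pgm1. Qed.

Lemma pgVK x y : x ** (pg_inv x ** y) = y.
Proof. by rewrite pg_mulA pgmV pg_mul1. Qed.

Lemma pg_invK x : pg_inv (pg_inv x) = x.
Proof. by apply: (@pg_mulI (pg_inv x)); rewrite pgmV pg_mulV. Qed.

Lemma pg_invM x y : pg_inv (x ** y) = pg_inv y ** pg_inv x.
Proof. by apply: (@pg_mulI (x ** y)); rewrite pgmV -pg_mulA pgVK pgmV. Qed.

Lemma pg_inv1 : pg_inv (pg_one : G) = pg_one.
Proof. by apply: (@pg_mulI pg_one); rewrite pgmV pg_mul1. Qed.

(* Word normal form: right-associated and freely reduced. *)
Definition pgE := (pg_invM, pg_invK, pg_inv1,
  fun x y z => esym (pg_mulA x y z), pgK, pgVK, pgmV, @pg_mulV G, pgm1, @pg_mul1 G).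

Lemma pg_powS x n : pg_pow x n.+1 = x ** pg_pow x n. Proof. by []. Qed.

Lemma pg_powD x m n : pg_pow x (m + n) = pg_pow x m ** pg_pow x n.
Proof. by elim: m => [|m IH]; rewrite ?pg_mul1 // addSn !pg_powS IH pgE. Qed.

Lemma pg_pow1 x : pg_pow x 1 = x. Proof. exact: pgm1. Qed.

Lemma pg_powSr x n : pg_pow x n.+1 = pg_pow x n ** x.
Proof. by rewrite -addn1 pg_powD pg_pow1. Qed.

Lemma pg_powM x m n : pg_pow x (m * n) = pg_pow (pg_pow x m) n.
Proof. by elim: n => [|n IH]; rewrite ?muln0 // mulnS pg_powD IH. Qed.

Lemma is_subgroup_pow (H : set G) x n : is_subgroup H -> H x -> H (pg_pow x n).
Proof. by case=> H1 [HM _] Hx; elim: n => // n IH; rewrite pg_powS; apply: HM. Qed.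

Lemma closed_gen_subgroup (A : set G) : is_subgroup (closed_gen A).
Proof.
split=> [H [[] //]|]; split=> [x y Ax Ay H HP|x Ax H HP];
  have [[_ [HM HV]] _] := HP; [apply: HM|apply: HV]; solve [exact: Ax|exact: Ay].
Qed.

Lemma closed_gen_closed (A : set G) : closed (closed_gen A).
Proof. by apply: closed_bigI => H [_ [cH _]]. Qed.

Lemma sub_closed_gen (A : set G) : A `<=` closed_gen A.
Proof. by move=> x Ax H [_ [_ AH]]; apply: AH. Qed.

Lemma closed_gen_min (A H : set G) :
  is_subgroup H -> closed H -> A `<=` H -> closed_gen A `<=` H.
Proof. by move=> sH cH AH x; apply. Qed.

Lemma lpcS p k : lpc G p k.+2 = lpc_step p (lpc G p k.+1). Proof. by []. Qed.

Lemma lpc_subgroup p k : is_subgroup (lpc G p k).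
Proof.
by case: k => [|[|k]]; rewrite ?lpcS; [split|split|exact: closed_gen_subgroup].
Qed.

Lemma lpc_closed p k : closed (lpc G p k).
Proof.
case: k => [|[|k]]; rewrite ?lpcS; [exact: closedT|exact: closedT|].
exact: closed_gen_closed.
Qed.

Lemma lpc_pow p k x : lpc G p k.+1 x -> lpc G p k.+2 (pg_pow x p).
Proof. by move=> Px; rewrite lpcS; apply: sub_closed_gen; left; exists x. Qed.

Lemma lpc_comm p k x y : lpc G p k.+1 y -> lpc G p k.+2 (pg_comm x y).
Proof. by move=> Py; rewrite lpcS; apply: sub_closed_gen; right; exists x, y. Qed.

Lemma lpc_min p k (H : set G) : is_subgroup H -> closed H ->
  (forall x, lpc G p k.+1 x -> H (pg_pow x p)) ->
  (forall x y, lpc G p k.+1 y -> H (pg_comm x y)) -> lpc G p k.+2 `<=` H.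
Proof.
move=> sH cH Hp Hc; rewrite lpcS; apply: closed_gen_min => // z [[x Px <-]|].
  exact: Hp.
by case=> x [y [Py ->]]; apply: Hc.
Qed.

Lemma lpc_sub p k : lpc G p k.+2 `<=` lpc G p k.+1.
Proof.
elim: k => [//|k IH]; apply: lpc_min => [||x Px|x y /IH Py].
- exact: lpc_subgroup.
- exact: lpc_closed.
- exact: is_subgroup_pow (lpc_subgroup _ _) Px.
- exact: lpc_comm.
Qed.

Lemma pg_mulr_continuous x : continuous (pg_mul x).
Proof.
move=> y; apply: (@continuous2_cvg _ _ _ _ (nbhs y) _ (fun=> x) id (@pg_mul G)).
- exact: (@pg_mul_cont G (x, y)).
- exact: cvg_cst.
- exact: cvg_id.
Qed.

Lemma near_coset (W : set G) : nbhs pg_one W ->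
  forall x, \forall y \near x, W (pg_inv x ** y).
Proof.
move=> nW x; have := @pg_mulr_continuous (pg_inv x) x.
by rewrite /continuous_at pg_mulV; apply.
Qed.

(* For a clopen [K] contained in [U], the translations which together with
   their inverses preserve [K] form an open subgroup contained in [K]. *)
Lemma open_subgroup_nbhs1 (U : set G) : nbhs pg_one U ->
  exists V, [/\ is_subgroup V, nbhs pg_one V & V `<=` U].
Proof.
move=> nU; have zG := compact_tdisc_zero_dimensional _
  (@pg_compact G) (@pg_hausdorff G) (@pg_tdisc G).
have [K [K1 [oK cK]] KU] := zero_dimensional_cvg (@pg_hausdorff G) zG
  (@pg_compact G) nU.
exists [set x | forall k, K k -> K (x ** k) /\ K (pg_inv x ** k)]; split.
- split=> [k Kk|]; first by rewrite !pgE.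
  split=> [x y Vx Vy k Kk|x Vx k Kk]; last by rewrite pg_invK; case: (Vx k Kk).
  by rewrite pg_invM -!pg_mulA; split; [apply (Vx _), (Vy _)|apply (Vy _), (Vx _)].
(* Tube argument: both conditions hold for pairs near [(k, 1)], hence by compactness for all [k] in
   [K] at once when [x] is near 1. *)
- have /compact_near_coveringP cK' : compact K.
    exact: subclosed_compact cK (@pg_compact G) (fun _ _ => I).
  apply: (cK' G (nbhs (pg_one : G)) (fun x k => K (x ** k) /\ K (pg_inv x ** k))).
  move=> k Kk.
  have c1 : (fun z : G * G => z.2 ** z.1) @ (k, pg_one : G) --> k.
    rewrite -[X in _ --> X]pg_mul1.
    apply: (@continuous2_cvg _ _ _ _ _ _ snd fst (@pg_mul G)).
    + exact: (@pg_mul_cont G (_, _)).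
    + exact: cvg_snd.
    + exact: cvg_fst.
  have c2 : (fun z : G * G => pg_inv z.2 ** z.1) @ (k, pg_one : G) --> k.
    rewrite -[X in _ --> X]pg_mul1 -[in X in _ --> X]pg_inv1.
    apply: (@continuous2_cvg _ _ _ _ _ _ (pg_inv \o snd) fst (@pg_mul G)).
    + exact: (@pg_mul_cont G (_, _)).
    + apply: (@cvg_comp _ _ _ snd pg_inv _ (nbhs (pg_one : G))); first exact: cvg_snd.
      exact: (@pg_inv_cont G).
    + exact: cvg_fst.
  have nK : nbhs k K by exact: open_nbhs_nbhs.
  by apply: filterI; [exact: c1|exact: c2].
- by move=> x Vx; apply: KU; rewrite -(pgm1 x); apply Vx.
Qed.

End PgTheory.

(** * The group [Mod_(p^3)] *)

(* Writing elements as [y^j x^i], and not [x^i y^j], makes the extension cocycle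
   [Bock phi + phi cup psi], with [phi] the left factor. *)
Lemma mod_p3_generators (p : nat) : prime p ->
  exists x y : 'Mod_(p ^ 3),
  [/\ #[x]%g = (p ^ 2)%N /\ #[y]%g = p,
      forall i j : nat, ((x ^+ i) ^ (y ^+ j) = x ^+ (i * (j * p).+1))%g,
      forall m, exists i j : nat, [/\ i < p ^ 2, j < p & m = y ^+ j * x ^+ i]%g
    & forall i j i' j' : nat, (y ^+ j * x ^+ i = y ^+ j' * x ^+ i')%g ->
        i = i' %[mod p ^ 2] /\ j = j' %[mod p]].
Proof.
move=> p_pr; have n_gt2 : (2 < 3)%N by [].
have [[x y] gen_xy mod_xy] := generators_modular_group p_pr n_gt2 (isog_refl _).
have [_ _ ox _] := gen_xy; have [oy _] := mod_xy; exists x, y.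
have [[/sdprodP[_ defG _ tiXY] _ conjXY] _ _ _ _] :=
  modular_group_structure p_pr n_gt2 gen_xy (isog_refl _) mod_xy.
(* Inverting the semidirect factorisation moves the powers of [y] to the left. *)
have defG' : (<[y]> * <[x]> = [set: 'Mod_(p ^ 3)]%G)%g.
  have -> : (<[y]> * <[x]>)%g = ((<[x]> * <[y]>)^-1)%g.
    by rewrite invMg !invGid.
  by rewrite defG; apply/setP => m; rewrite !inE.
split=> // [i j|m|i j i' j' /eqP].
- by rewrite conjXY ?mem_cycle // expn1 expgM.
- have : m \in (<[y]> * <[x]>)%g by rewrite defG' inE.
  case/mulsgP=> _ _ /cyclePmin[j ltj ->] /cyclePmin[i lti ->] ->.
  by exists i, j; split=> //; rewrite -?ox -?oy.
move=> /eqP eqm.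
(* This element is a power of both [x] and [y], and the two cyclic groups meet trivially. *)
have eqz : (y ^- j' * y ^+ j = x ^+ i' * x ^- i)%g.
  apply: (mulIg (x ^+ i)%g); rewrite mulgKV -mulgA eqm mulKg //.
have : (y ^- j' * y ^+ j \in <[x]> :&: <[y]>)%g.
  rewrite inE {1}eqz !(groupM, groupV, groupX) ?cycle_id //.
rewrite tiXY inE => /eqP z1; split; apply/eqP.
  rewrite -ox -eq_expg_mod_order eq_sym; apply/eqP.
  by apply: (mulIg (x ^- i)%g); rewrite mulgV -eqz.
rewrite -oy -eq_expg_mod_order; apply/eqP.
by apply: (mulgI (y ^- j')%g); rewrite mulVg.
Qed.

(** * Separation by cochains *)

Section Separation.
Local Open Scope ring_scope.
Variables (G : ProfiniteGroup) (p : nat).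
Hypothesis p_pr : prime p.

(** Zorn's lemma for the sets [A] such that the union of [A] and [W0] is a subgroup avoiding [g];
    adjoining [W0] makes the empty chain harmless. *)
Lemma maximal_subgroup_avoiding (W0 : set G) (g : G) :
  is_subgroup W0 -> ~ W0 g ->
  exists W, [/\ is_subgroup W, W0 `<=` W, ~ W g &
    forall B b, is_subgroup B -> W `<=` B -> B b -> ~ W b -> B g].
Proof.
move=> [W01 [W0M W0V]] nW0g.
pose avoid (A : set G) := is_subgroup (A `|` W0) /\ ~ (A `|` W0) g.
have [F Fav Ftot|A [[sA nAg] maxA]] := @Zorn_bigcup _ avoid.
- split; last first.
    case=> // -[X FX Xg]; have [_ nX] := Fav _ FX; by apply: nX; left.
  have inF X x : F X -> (X `|` W0) x -> ((\bigcup_(Y in F) Y) `|` W0) x.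
    by move=> FX [Xx|]; [left; exists X|right].
  split; first by right.
  split=> [x y [[X FX Xx]|W0x] [[Y FY Yy]|W0y]|x [[X FX Xx]|W0x]].
  + have [XY|YX] := Ftot _ _ FX FY.
      apply: (inF Y) => //; have [[_ [YM _]] _] := Fav _ FY.
      by apply: YM; left => //; exact: XY.
    apply: (inF X) => //; have [[_ [XM _]] _] := Fav _ FX.
    by apply: XM; left => //; exact: YX.
  + by apply: (inF X) => //; have [[_ [XM _]] _] := Fav _ FX; apply: XM; [left|right].
  + by apply: (inF Y) => //; have [[_ [YM _]] _] := Fav _ FY; apply: YM; [right|left].
  + by right; apply: W0M.
  + by apply: (inF X) => //; have [[_ [_ XV]] _] := Fav _ FX; apply: XV; left.
  + by right; apply: W0V.
exists (A `|` W0); split=> // B b sB AB Bb nAb.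
apply: contrapT => nBg; apply: (maxA B).
  by split=> [|BA]; [move=> x Ax; apply: AB; left|apply: nAb; left; exact: BA].
rewrite /avoid; suff -> : B `|` W0 = B by split.
by apply/setUidPl => x W0x; apply: AB; right.
Qed.

(** Take [W = H V] with [V] an open subgroup so small that [g V] misses the closed set [H]. The
    commutator hypothesis makes [H] normal, so [H V] is a subgroup. *)
Lemma open_subgroup_avoiding (H : set G) (g : G) :
  is_subgroup H -> closed H -> (forall x y, H y -> H (pg_comm x y)) -> ~ H g ->
  exists W, [/\ is_subgroup W, nbhs pg_one W, H `<=` W & ~ W g].
Proof.
move=> [H1 [HM HV]] cH HC nHg.
have HJ x h : H h -> H (x ** h ** pg_inv x).
  move=> Hh; have := HM _ _ (HC (pg_inv x) _ (HV _ Hh)) Hh.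
  by rewrite /pg_comm !pgE.
have nU : nbhs (pg_one : G) (fun v => ~ H (g ** pg_inv v)).
  have : (fun v : G => g ** pg_inv v) @ (pg_one : G) --> g.
    rewrite -[X in _ --> X]pgm1 -[in X in _ --> X]pg_inv1.
    apply: (@continuous2_cvg _ _ _ _ _ _ (fun=> g) pg_inv (@pg_mul G)).
    + exact: (@pg_mul_cont G (_, _)).
    + exact: cvg_cst.
    + exact: (@pg_inv_cont G).
  by move=> cv; apply: (cv (~` H)); apply: open_nbhs_nbhs; split=> //; exact: closed_openC.
have [V [[V1 [VM VV]] nV VU]] := open_subgroup_nbhs1 _ _ nU.
exists [set x | exists h v, [/\ H h, V v & x = h ** v]]; split.
- split; first by exists pg_one, pg_one; rewrite !pgE.
  split=> [_ _ [h [v [Hh Vv ->]]] [h' [v' [Hh' Vv' ->]]]|_ [h [v [Hh Vv ->]]]].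
    exists (h ** (v ** h' ** pg_inv v)), (v ** v'); rewrite !pgE.
    by split=> //; [apply: (HM) => //; have := HJ v _ Hh'; rewrite !pgE|apply: VM].
  exists (pg_inv v ** pg_inv h ** v), (pg_inv v); rewrite !pgE.
  split=> //; [have := HJ (pg_inv v) _ (HV _ Hh); by rewrite !pgE|exact: VV].
- apply: filterS nV => v Vv; exists pg_one, v; by rewrite !pgE.
- by move=> h Hh; exists h, pg_one; rewrite !pgE.
- by move=> [h [v [Hh Vv e]]]; apply: (VU _ Vv); rewrite e !pgE.
Qed.

Variables P W : set G.
Hypotheses (sP : is_subgroup P) (sW : is_subgroup W).
Hypothesis WJ : forall x w, P x -> W w -> W (pg_inv x ** w ** x).
Hypothesis Wp : forall x, P x -> W (pg_pow x p).

(* The subgroup [W<x>]; only nonnegative exponents are needed as [x^p] is in [W]. *)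
Let adj (x : G) : set G := [set b | exists k : nat, W (b ** pg_pow x k)].

Let PX x k : P x -> P (pg_pow x k). Proof. exact: is_subgroup_pow. Qed.

(** As [P] normalises [W], the second factor may be conjugated by [pg_pow x k] before multiplying,
    which adds the exponents. *)
Let adjM x b b' k k' : P x -> W (b ** pg_pow x k) -> W (b' ** pg_pow x k') ->
  W (b ** b' ** pg_pow x (k + k')).
Proof.
move=> Px Wb Wb'; have [_ [WM _]] := sW.
have := WM _ _ Wb (WJ (pg_pow x k) _ (PX x k Px) Wb').
by rewrite addnC pg_powD !pgE.
Qed.

Let adj_subgroup x : P x -> is_subgroup (adj x).
Proof.
move=> Px; have [W1 [WM WV]] := sW; split; first by exists 0%N; rewrite pgm1.
split=> [b b' [k Wb] [k' Wb']|b [k Wb]].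
  by exists (k + k')%N; exact: adjM.
(* Modulo [p] this exponent is [- k]. *)
exists (k * p.-1)%N; rewrite pg_powM.
set z := pg_pow x k in Wb *; have Pz : P z by exact: PX.
have Wz : W (z ** pg_pow z p.-1).
  by have := Wp z Pz; rewrite -{1}(prednK (prime_gt0 p_pr)).
have := WM _ _ (WJ (pg_inv z) _ (sP.2.2 _ Pz) (WV _ Wb)) Wz.
by rewrite !pgE.
Qed.

Let sub_adj x : W `<=` adj x.
Proof. by move=> w Ww; exists 0%N; rewrite pgm1. Qed.

Let mem_adj x : P x -> adj x x.
Proof.
by move=> Px; exists p.-1; have := Wp x Px; rewrite -{1}(prednK (prime_gt0 p_pr)).
Qed.

Variable g : G.
Hypotheses (Pg : P g) (nWg : ~ W g).

(** Bezout: if [p] did not divide [k], then [u k = v p + 1] for some [u] and [v], and [x] would be a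
    product of powers of [pg_pow x k] and [pg_pow x p], both in [W]. *)
Let pow_mem_dvd x k : P x -> ~ W x -> W (pg_pow x k) -> (p %| k)%N.
Proof.
move=> Px nWx Wk; apply: contrapT => /negP; rewrite -prime_coprime // => cpk.
have [|u v e _] := @egcdnP k p; first by case: k Wk cpk => //; rewrite /coprime gcdn0; case: p p_pr => [|[]].
move: e; rewrite gcdnC (eqP cpk) => e; apply: nWx.
have := is_subgroup_pow _ _ (pg_pow x k) u sW Wk.
rewrite -pg_powM mulnC e addn1 pg_powS mulnC pg_powM => Wx.
have [_ [WM WV]] := sW.
have := WM _ _ Wx (WV _ (is_subgroup_pow _ _ _ v sW (Wp x Px))).
by rewrite !pgE.
Qed.

Hypothesis maxW : forall B b, is_subgroup B -> W `<=` B -> B b -> ~ W b -> B g.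

(** For [x] outside [W], maximality puts [g] in [W<x>], so [g x^k] is in [W] for some [k]. As [g] is
    not in [W], [p] does not divide [k]; raising to an inverse [u] of [k] modulo [p] puts [x g^u] in
    [W]. *)
Let P_adj x : P x -> adj g x.
Proof.
move=> Px; have [Wx|nWx] := pselect (W x); first exact: sub_adj.
have [k Wk] := maxW _ _ (adj_subgroup x Px) (@sub_adj x) (mem_adj x Px) nWx.
have [W1 [WM WV]] := sW.
have npk : ~~ (p %| k)%N.
  apply/negP => /dvdnP[q e]; apply: nWg; rewrite e mulnC pg_powM in Wk.
  have := WM _ _ Wk (WV _ (is_subgroup_pow _ _ _ q sW (Wp x Px))).
  by rewrite !pgE.
have [|u v e _] := @egcdnP k p; first by case: k npk {Wk} => //; rewrite dvdn0.
move: npk; rewrite -prime_coprime // => npk.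
move: e; rewrite gcdnC (eqP npk) => e.
have Wm m : W (pg_pow g m ** pg_pow (pg_pow x k) m).
  elim: m => [|m IH]; first by rewrite pgm1.
  have := WM _ _ Wk (WJ _ _ (PX x k Px) IH).
  by rewrite pg_powS (pg_powSr _ _ m) !pgE.
have {}Wm := Wm u; rewrite -!pg_powM [(k * u)%N]mulnC e addn1 pg_powS in Wm.
exists u; have := WM _ _ Wm (WV _ (is_subgroup_pow _ _ _ v sW (Wp x Px))).
rewrite -pg_powM mulnC !pgE => /(WJ _ _ (PX g u Pg)).
by rewrite !pgE.
Qed.

Let exponent_unique b k k' : W (b ** pg_pow g k) -> W (b ** pg_pow g k') ->
  k%:R = k'%:R :> 'Z_p.
Proof.
wlog lekk : k k' / (k <= k')%N.
  by move=> IH; case: (leqP k k') => [/IH//|/ltnW/IH IH' Wk Wk']; rewrite IH'.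
move=> Wk; rewrite -(subnKC lekk) pg_powD => Wk'.
have [_ [WM WV]] := sW; have /dvdnP[q ->] : (p %| k' - k)%N.
  by apply: (pow_mem_dvd g) => //; have := WM _ _ (WV _ Wk) Wk'; rewrite !pgE.
by rewrite natrD natrM pchar_Zp ?prime_gt1 // mulr0 addr0.
Qed.

(** On [W<g>] this is minus the exponent of [g] modulo [W], well defined modulo [p]. *)
Let idx (b : G) : 'Z_p := (xget 0%N [set k | W (b ** pg_pow g k)])%:R.

Let idxE b k : W (b ** pg_pow g k) -> idx b = k%:R.
Proof.
by move=> Wk; have Wx := @xgetI _ 0%N [set k | _] k Wk; exact: exponent_unique Wx Wk.
Qed.

Let idxM b b' : adj g b -> adj g b' -> idx (b ** b') = idx b + idx b'.
Proof.
move=> [k Wk] [k' Wk']; rewrite (idxE _ _ Wk) (idxE _ _ Wk') -natrD.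
by apply: idxE; exact: adjM.
Qed.

Let repr (x : G) : G := xget pg_one [set t | adj g (pg_inv t ** x)].

Let repr_adj x : adj g (pg_inv (repr x) ** x).
Proof.
have [L1 _] := adj_subgroup g Pg.
apply: (@xgetI _ pg_one [set t | adj g (pg_inv t ** x)] x).
by rewrite /= pg_mulV.
Qed.

Let reprM x b : adj g b -> repr (x ** b) = repr x.
Proof.
have [L1 [LM LV]] := adj_subgroup g Pg.
move=> Lb; rewrite /repr; congr (xget _ _); apply/seteqP; split=> t /= Lt.
  by have := LM _ _ Lt (LV _ Lb); rewrite !pgE.
by have := LM _ _ Lt Lb; rewrite !pgE.
Qed.

(* On [L = W<g>] take the homomorphism [L -> L/W = Z/p]; extend it to [G] through
   representatives of the left cosets of [L]. *)
Lemma maximal_subgroup_cochain : nbhs (pg_one : G) W ->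
  exists f : G -> 'Z_p, [/\ cont1 f,
    forall x u, P u -> f (x ** u) = f x + f u,
    forall h, W h -> f h = 0 & f g != 0].
Proof.
move=> nW; have fM x b : adj g b ->
    idx (pg_inv (repr (x ** b)) ** (x ** b)) = idx (pg_inv (repr x) ** x) + idx b.
  by move=> Lb; rewrite reprM // pg_mulA idxM //; exact: repr_adj.
have f1 b : adj g b ->
    idx (pg_inv (repr b) ** b) = idx (pg_inv (repr pg_one) ** pg_one) + idx b.
  by move=> /(fM pg_one b); rewrite pg_mul1.
have idxW w : W w -> idx w = 0 by move=> Ww; apply: (@idxE _ 0%N); rewrite pgm1.
(* The chosen representative of [L] itself need not be 1; subtracting the value at 1 makes the
   function agree with [idx] on [L]. *)
exists (fun x => idx (pg_inv (repr x) ** x) - idx (pg_inv (repr pg_one) ** pg_one)).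
split=> [z|x u Pu|h Wh|].
- rewrite openE => x /= <-; have := near_coset _ _ nW x; apply: filterS => y Wxy /=.
  by rewrite -[y](pgVK _ x) (fM _ _ (sub_adj g _ Wxy)) (idxW _ Wxy) addr0.
- rewrite (fM _ _ (P_adj _ Pu)) (f1 _ (P_adj _ Pu)).
  by rewrite [idx (pg_inv (repr pg_one) ** pg_one) + _]addrC addrK addrAC.
- by rewrite (f1 _ (sub_adj g _ Wh)) (idxW _ Wh) addr0 subrr.
- rewrite (f1 _ (P_adj _ Pg)).
  (* As [g^p] lies in [W], the value at [g] is [p - 1 = -1], which is nonzero. *)
  rewrite addrAC subrr add0r (@idxE _ p.-1); last first.
    by rewrite -pg_powS prednK ?prime_gt0 //; exact: Wp.
  apply/eqP => e; have := oner_neq0 'Z_p.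
  rewrite -(pchar_Zp (prime_gt1 p_pr)) -[X in X%:R](prednK (prime_gt0 p_pr)).
  by rewrite -natr1 e add0r eqxx.
Qed.

End Separation.

(** Any subgroup containing [lpc G p k.+2] contains the [p]-th powers of [P = lpc G p k.+1] and is
    normalised by [P], since it contains the commutators with [P]. So the construction applies to a
    maximal such open subgroup avoiding [g]. *)
Lemma lpc_separation (G : ProfiniteGroup) (p k : nat) (g : G) : prime p ->
  lpc G p k.+1 g -> ~ lpc G p k.+2 g ->
  exists f : G -> 'Z_p, [/\ cont1 f,
    forall x u, lpc G p k.+1 u -> f (x ** u) = (f x + f u)%R,
    forall h, lpc G p k.+2 h -> f h = 0%R & f g != 0%R].
Proof.
move=> p_pr Pg nHg; have sH := lpc_subgroup G p k.+2; have sP := lpc_subgroup G p k.+1.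
have [|V [sV nV HV nVg]] := open_subgroup_avoiding _ _ _ sH (@lpc_closed _ _ _) _ nHg.
  by move=> x y /lpc_sub; exact: lpc_comm.
have [W [sW VW nWg maxW]] := maximal_subgroup_avoiding _ _ _ sV nVg.
have HW : lpc G p k.+2 `<=` W by move=> x /HV; exact: VW.
have [||f [cf fD fW fg]] :=
  maximal_subgroup_cochain _ _ p_pr _ _ sP sW _ _ _ Pg nWg maxW (filterS VW nV).
- move=> x w Px Ww; have [_ [WM _]] := sW.
  by have := WM _ _ Ww (HW _ (lpc_comm _ _ _ w _ Px)); rewrite /pg_comm !pgE.
- by move=> x /lpc_pow; exact: HW.
by exists f; split=> // h /HW; exact: fW.
Qed.

(** * Linear algebra of homomorphisms to Z/p *)

Lemma Zp_unit (p : nat) (z : 'Z_p) : prime p -> (z != 0 -> z \is a GRing.unit)%R.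
Proof.
move=> p_pr z0; rewrite -[z]natr_Zp unitZpE ?prime_gt1 // prime_coprime //.
by rewrite gtnNdvd // ?lt0n // -[X in (_ < X)%N](Zp_cast (prime_gt1 p_pr)).
Qed.

Section LinearCombination.
Local Open Scope ring_scope.
Variables (G : ProfiniteGroup) (p : nat).
Hypothesis p_pr : prime p.

Definition additive_on (P : set G) (f : G -> 'Z_p) : Prop :=
  forall x y, P x -> P y -> f (x ** y) = f x + f y.

Lemma additive_on1 P f : is_subgroup P -> additive_on P f -> f pg_one = 0.
Proof.
move=> [P1 _] fD; have := fD _ _ P1 P1; rewrite pg_mul1 => /eqP.
by rewrite -subr_eq0 opprD addNKr oppr_eq0 => /eqP.
Qed.

Lemma additive_on_pow P f x n : is_subgroup P -> additive_on P f -> P x ->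
  f (pg_pow x n) = f x *+ n.
Proof.
move=> sP fD Px; elim: n => [|n IH]; first exact: additive_on1 sP fD.
by rewrite pg_powS fD ?IH ?mulrS //; exact: is_subgroup_pow.
Qed.

Lemma additive_onV P f x : is_subgroup P -> additive_on P f -> P x ->
  f (pg_inv x) = - f x.
Proof.
move=> sP fD Px; have [_ [_ PV]] := sP; apply/eqP; rewrite -addr_eq0.
by rewrite -fD ?pg_mulV ?(additive_on1 _ _ sP fD) //; exact: PV.
Qed.

(** Induction on [n]: on the kernel of the first [e i], [f] is a combination of the others; the
    remainder [r] vanishes on that kernel and is thus a multiple of the first. *)
Lemma linear_combination_of_ker (n : nat) (P : set G) (e : 'I_n -> G -> 'Z_p)
    (f : G -> 'Z_p) :
  is_subgroup P -> (forall i, additive_on P (e i)) -> additive_on P f ->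
  (forall u, P u -> (forall i, e i u = 0) -> f u = 0) ->
  exists a : 'I_n -> 'Z_p, forall u, P u -> f u = \sum_(i < n) a i * e i u.
Proof.
elim: n P e => [|n IH] P e sP eD fD ker_e.
  by exists (fun=> 0) => u Pu; rewrite big_ord0 ker_e // => -[].
have [P1 [PM PV]] := sP; pose P' u := P u /\ e ord0 u = 0.
have sP' : is_subgroup P'.
  split; first by split=> //; exact: additive_on1 sP (eD _).
  split=> [x y [Px ex] [Py ey]|x [Px ex]].
    by split; [exact: PM|rewrite eD // ex ey addr0].
  by split; [exact: PV|rewrite (additive_onV _ _ _ sP (eD _)) ?ex ?oppr0].
have [||u [Pu eu0] eu|a fa] := IH P' (fun i => e (lift ord0 i)) sP'.
- by move=> i x y [Px _] [Py _]; exact: eD.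
- by move=> x y [Px _] [Py _]; exact: fD.
- by apply: ker_e => // i; case: (unliftP ord0 i) => [j ->|->].
pose r u := f u - \sum_(i < n) a i * e (lift ord0 i) u.
have rD : additive_on P r.
  move=> x y Px Py; rewrite /r fD // addrACA -opprD -big_split /=.
  by congr (_ - _); apply: eq_bigr => i _; rewrite eD // mulrDr.
have r0 u : P' u -> r u = 0 by move=> Pu; rewrite /r fa // subrr.
suff [b rb] : exists b, forall u, P u -> r u = b * e ord0 u.
  exists (fun i => if unlift ord0 i is Some j then a j else b) => u Pu.
  rewrite big_ord_recl unlift_none -rb // /r.
  rewrite -[LHS](subrK (\sum_(i < n) a i * e (lift ord0 i) u)); congr (_ + _).
  by apply: eq_bigr => i _; rewrite liftK.
have [[x [Px ex]]|ne] := pselect (exists x, P x /\ e ord0 x != 0); last first.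
  exists 0 => u Pu; rewrite mul0r r0 //; split=> //.
  by apply: contrapT => /eqP eu; apply: ne; exists u.
have ux := Zp_unit _ _ p_pr ex.
(* The exponent [k] is chosen to bring [u x^k] into the kernel of [e ord0]. *)
exists (r x / e ord0 x) => u Pu; pose k : 'Z_p := - (e ord0 u / e ord0 x).
have eM g : additive_on P g -> g (u ** pg_pow x k) = g u + k * g x.
  move=> gD; rewrite gD // ?(additive_on_pow _ _ _ _ sP gD) //; last exact: is_subgroup_pow.
  by rewrite -mulr_natl natr_Zp.
have /r0 : P' (u ** pg_pow x k).
  split; first by apply: PM => //; exact: is_subgroup_pow.
  by rewrite eM // /k mulNr divrK // subrr.
rewrite eM // => /eqP; rewrite addr_eq0 => /eqP ->.
by rewrite /k mulNr opprK mulrC mulrCA mulrC.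
Qed.

End LinearCombination.

(** * Transgression *)

Section LocallyConstant.
Variables (T : topologicalType) (Y : Type) (f : T -> Y).

Lemma locally_constantP :
  (forall z, open (f @^-1` [set z])) <-> forall x, \forall y \near x, f y = f x.
Proof.
split=> [of_ x|nf z].
  by have := of_ (f x); rewrite openE; exact.
by rewrite openE => x /= <-; apply: filterS (nf x) => y.
Qed.

Lemma locally_constant_open : (forall z, open (f @^-1` [set z])) ->
  forall A, open (f @^-1` A).
Proof.
move=> /locally_constantP nf A; rewrite openE => x Afx.
by apply: filterS (nf x) => y /= ->.
Qed.

Lemma locally_constant_closed : (forall z, open (f @^-1` [set z])) ->
  forall A, closed (f @^-1` A).
Proof.
move=> of_ A; rewrite -[A]setCK -preimage_setC.
by apply: open_closedC; exact: locally_constant_open.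
Qed.

End LocallyConstant.

Section Transgression.
Local Open Scope ring_scope.
Variables (G : ProfiniteGroup) (p : nat).
Hypothesis p_pr : prime p.
Implicit Types (f : G -> 'Z_p) (c : G -> G -> 'Z_p).

Lemma hom_lpc2 f u : cont1 f -> {morph f : x y / x ** y >-> x + y} ->
  lpc G p 2 u -> f u = 0.
Proof.
move=> cf fM; have sT : is_subgroup [set: G] by [].
have fD : additive_on _ _ [set: G] f by move=> x y _ _; exact: fM.
apply: (@lpc_min _ _ 0 [set u | f u = 0]) => [||x _|x y _] /=.
- split; first exact: additive_on1 sT fD.
  split=> [x y /= fx fy|x /= fx]; first by rewrite fM fx fy addr0.
  by rewrite (additive_onV _ _ _ _ _ sT fD) // fx oppr0.
- exact: (locally_constant_closed _ _ _ cf [set 0]).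
- rewrite (additive_on_pow _ _ _ _ _ _ sT fD) //.
  by rewrite -mulr_natl pchar_Zp ?prime_gt1 // mul0r.
- rewrite /pg_comm !fM !(additive_onV _ _ _ _ _ sT fD) //.
  by rewrite addrACA addNr addNr addr0.
Qed.

(** Inflation gives [c x u = c x 1]; expand both sides as coboundaries of [f]. *)
Lemma infl2_delta1 c f x u : infl2 c -> (forall x y, c x y = delta1 f x y) ->
  lpc G p 2 u -> f (x ** u) = f x + (f u - f pg_one).
Proof.
move=> ic cE Pu; have [P1 _] := lpc_subgroup G p 2.
have := ic x pg_one _ _ P1 Pu; rewrite !pgE !cE /delta1 !pgE subrK => /eqP.
by rewrite eq_sym => /eqP ->; ring.
Qed.

Lemma infl2_delta1l c f x u : infl2 c -> (forall x y, c x y = delta1 f x y) ->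
  lpc G p 2 u -> f (u ** x) = f x + (f u - f pg_one).
Proof.
move=> ic cE Pu; have [P1 _] := lpc_subgroup G p 2.
have := ic pg_one x _ _ Pu P1; rewrite !pgE !cE /delta1 !pgE subrr add0r => /eqP.
by rewrite eq_sym => /eqP ->; ring.
Qed.

(** On [lpc G p 2] the function [F = f - f 1] is a homomorphism to Z/p invariant under conjugation
    by [G], so it kills [p]-th powers and commutators with [G]. *)
Lemma infl2_delta1_lpc3 c f u : infl2 c -> cont1 f ->
  (forall x y, c x y = delta1 f x y) -> lpc G p 3 u -> f u = f pg_one.
Proof.
move=> ic cf cE; pose F x := f x - f pg_one.
have [P1 [PM PV]] := lpc_subgroup G p 2.
have fr x v : lpc G p 2 v -> F (x ** v) = F x + F v.
  by move=> Pv; rewrite /F (infl2_delta1 _ _ _ _ ic cE Pv) addrAC.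
have fl x v : lpc G p 2 v -> F (v ** x) = F x + F v.
  by move=> Pv; rewrite /F (infl2_delta1l _ _ _ _ ic cE Pv) addrAC.
have FD : additive_on _ _ (lpc G p 2) F by move=> x y _; exact: fr.
have sP := lpc_subgroup G p 2.
have cH : closed [set x | lpc G p 2 x /\ F x = 0].
  suff cF : closed [set x | F x = 0] by apply: closedI cF; exact: lpc_closed.
  have -> : [set x | F x = 0] = f @^-1` [set f pg_one].
    by apply/seteqP; split=> x /= e; apply/eqP; [rewrite -subr_eq0|rewrite subr_eq0]; exact/eqP.
  exact: locally_constant_closed.
suff sub : lpc G p 3 `<=` [set x | lpc G p 2 x /\ F x = 0].
  by move=> /sub[_ /eqP]; rewrite subr_eq0 => /eqP.
apply: lpc_min => [|//|x Px|x y Py].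
- split; first by split=> //; exact: subrr.
  split=> [x y [Px Fx] [Py Fy]|x [Px Fx]].
    by split; [exact: PM|rewrite FD // Fx Fy addr0].
  by split; [exact: PV|rewrite (additive_onV _ _ _ _ _ sP FD) // Fx oppr0].
- split; first by apply: lpc_sub; exact: lpc_pow.
  rewrite (additive_on_pow _ _ _ _ _ _ sP FD) //.
  by rewrite -mulr_natl pchar_Zp ?prime_gt1 // mul0r.
- split; first by apply: lpc_sub; exact: lpc_comm.
  (* The conjugate [z] of the inverse of [y] satisfies [x z = y^-1 x]; the right and left
     translation formulas give [F z = F (y^-1)]. *)
  pose z := pg_inv x ** pg_inv y ** x.
  have Pz : lpc G p 2 z.
    by have := PM _ _ (lpc_sub _ _ _ _ (lpc_comm _ _ _ x _ Py)) (PV _ Py); rewrite /z /pg_comm !pgE.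
  have FzV : F z = F (pg_inv y).
    apply: (addrI (F x)); rewrite -(fr x z Pz) -(fl x _ (PV _ Py)).
    by rewrite /z !pgE.
  have -> : pg_comm x y = z ** y by rewrite /pg_comm /z !pgE.
  by rewrite FD // FzV (additive_onV _ _ _ _ _ sP FD) // addNr.
Qed.

(** Two cochains with coboundary [c] differ by a homomorphism from [G] to Z/p, which vanishes on
    [lpc G p 2]; an inflated one is constant there. *)
Lemma B2_quotP c f : infl2 c -> cont1 f -> (forall x y, c x y = delta1 f x y) ->
  B2_quot c <-> forall u, lpc G p 2 u -> f u = f pg_one.
Proof.
move=> ic cf cE; split=> [[h [ch [ih hE]]] u Pu|f0]; last first.
  exists f; split=> //; split=> // x u Pu.
  by rewrite (infl2_delta1 _ _ _ _ ic cE Pu) (f0 _ Pu) subrr addr0.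
have hu : h u = h pg_one by rewrite -[u]pg_mul1 ih.
have dM : {morph (fun x => f x - h x) : x y / x ** y >-> x + y}.
  move=> x y /=; have := hE x y; rewrite cE /delta1 => e.
  have -> : f (x ** y) = f y + f x - (f y - f (x ** y) + f x) by ring.
  by rewrite e; ring.
have dc : cont1 (fun x => f x - h x).
  apply/locally_constantP => x.
  move/locally_constantP: cf => /(_ x); move/locally_constantP: ch => /(_ x).
  by apply: filterS2 => y -> ->.
have [P1 _] := lpc_subgroup G p 2.
have /eqP := hom_lpc2 _ _ dc dM Pu; have /eqP := hom_lpc2 _ _ dc dM P1.
by rewrite !subr_eq0 hu => /eqP -> /eqP.
Qed.

Lemma bock_cup_infl2 (phi psi : G -> 'Z_p) : H1_quot phi -> H1_quot psi ->
  infl2 (fun x y => bock phi x y + cup phi psi x y).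
Proof.
move=> [_ [iphi _]] [_ [ipsi _]] x y u v Pu Pv.
by rewrite /bock /cup !iphi // !ipsi.
Qed.

Lemma delta1_cont2 f : cont1 f -> cont2 (delta1 f).
Proof.
move=> /locally_constantP cf; apply/(@locally_constantP _ _ (fun xy => delta1 f xy.1 xy.2)).
case=> x y /=; have h1 : \forall z \near (x, y), f z.1 = f x.
    exact: (@cvg_fst _ _ (nbhs x) (nbhs y) _ _ (cf x)).
have h2 : \forall z \near (x, y), f z.2 = f y.
    exact: (@cvg_snd _ _ (nbhs x) (nbhs y) _ _ (cf y)).
have h3 : \forall z \near (x, y), f (z.1 ** z.2) = f (x ** y).
  exact: (@pg_mul_cont G (x, y) _ (cf _)).
by apply: filterS3 h1 h2 h3 => z; rewrite /delta1 => -> -> ->.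
Qed.

Lemma delta1_cocycle2 f : cocycle2 (delta1 f).
Proof. by move=> x y z; rewrite /delta1 pg_mulA; ring. Qed.

Lemma ker_inf_delta1 c f : cont1 f -> infl2 c ->
  (forall x y, c x y = delta1 f x y) -> ker_inf c.
Proof.
move=> cf ic cE; split; last by exists f.
have -> : c = delta1 f by apply/funext => x; apply/funext => y.
split; first exact: delta1_cont2.
split; last exact: delta1_cocycle2.
by move=> x y u v Pu Pv; rewrite -!cE; exact: ic.
Qed.

End Transgression.

(** * Homomorphisms to [Mod_(p^3)] *)

Section ModularHom.
Local Open Scope ring_scope.
Variables (G : ProfiniteGroup) (p : nat).
Hypothesis p_pr : prime p.

Definition splits_bock_cup (phi psi f : G -> 'Z_p) : Prop :=
  [/\ H1_quot phi, H1_quot psi, cont1 f &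
    forall x y, bock phi x y + cup phi psi x y = delta1 f x y].

Lemma H1_quot_hom (f : G -> 'Z_p) : cont1 f -> {morph f : x y / x ** y >-> x + y} ->
  H1_quot f.
Proof.
move=> cf fM; split=> //; split=> // x u Pu.
by rewrite fM (hom_lpc2 _ _ p_pr _ _ cf fM Pu) addr0.
Qed.

Lemma H1_quot0 (f : G -> 'Z_p) : H1_quot f -> f pg_one = 0.
Proof.
move=> [cf [_ fM]]; apply: (hom_lpc2 _ _ p_pr _ _ cf fM).
exact: (lpc_subgroup G p 2).1.
Qed.

Lemma splits_bock_cup1 (phi psi f : G -> 'Z_p) : splits_bock_cup phi psi f ->
  f pg_one = 0.
Proof.
move=> [Hphi Hpsi _ /(_ pg_one pg_one)].
rewrite /bock /cup /delta1 (H1_quot0 _ Hphi) (_ : nat_of_ord 0%R = 0%N) // addn0 div0n mul0r addr0 pg_mul1.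
by rewrite subrr add0r.
Qed.

Lemma splits_bock_cup_ker_inf (phi psi f : G -> 'Z_p) : splits_bock_cup phi psi f ->
  ker_inf (fun x y => bock phi x y + cup phi psi x y).
Proof.
by move=> [Hphi Hpsi cf fE]; apply: (ker_inf_delta1 _ _ _ f) => //; exact: bock_cup_infl2.
Qed.

Lemma modp_eq (m n : nat) : (m%:R = n%:R :> 'Z_p) <-> m = n %[mod p].
Proof.
split=> [/(congr1 val)/=|e]; first by rewrite !val_Zp_nat ?prime_gt1.
by apply: val_inj; rewrite /= !val_Zp_nat ?prime_gt1.
Qed.

Variables x y : 'Mod_(p ^ 3).
Hypotheses (ox : #[x]%g = (p ^ 2)%N) (oy : #[y]%g = p).
Hypothesis conj_xy :
  forall i j : nat, ((x ^+ i) ^ (y ^+ j) = x ^+ (i * (j * p).+1))%g.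
Hypothesis gen_xy : forall m, exists i j : nat,
  [/\ (i < p ^ 2)%N, (j < p)%N & m = y ^+ j * x ^+ i]%g.
Hypothesis inj_xy : forall i j i' j' : nat,
  (y ^+ j * x ^+ i = y ^+ j' * x ^+ i')%g ->
  i = i' %[mod p ^ 2] /\ j = j' %[mod p].

Let mul_xy i j i' j' : ((y ^+ j * x ^+ i) * (y ^+ j' * x ^+ i') =
  y ^+ (j + j') * x ^+ (i * (j' * p).+1 + i'))%g.
Proof. by rewrite !expgD -conj_xy conjgE !mulgA mulgK. Qed.

(** In base [p] the exponent of [x] has lower digit [phi] and upper digit [- f]. In a product, the
    carry of the lower digits contributes [bock phi] and moving [x] past [y] contributes
    [cup phi psi], so multiplicativity is the splitting equation. *)
Lemma modular_hom_of_splitting (phi psi f : G -> 'Z_p) : splits_bock_cup phi psi f ->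
  cont_hom_fin (fun g => y ^+ psi g * x ^+ (phi g + p * (- f g)%R)%N)%g.
Proof.
move=> [[cphi [_ phiM]] [cpsi [_ psiM]] cf fE]; split=> [a b|]; last first.
  apply/locally_constantP => g; move/locally_constantP: cphi => /(_ g).
  move/locally_constantP: cpsi => /(_ g); move/locally_constantP: cf => /(_ g).
  by apply: filterS3 => z -> -> ->.
rewrite mul_xy; congr (_ * _)%g.
  apply/eqP; rewrite eq_expg_mod_order oy; apply/eqP/modp_eq.
  by rewrite natrD !natr_Zp psiM.
apply/eqP; rewrite eq_expg_mod_order ox.
have phiE : ((phi a : nat) + phi b = phi (a ** b) + p * ((phi a + phi b) %/ p))%N.
  have -> : phi (a ** b) = ((phi a : nat) + phi b)%N%:R.
    by rewrite phiM natrD !natr_Zp.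
  by rewrite val_Zp_nat ?prime_gt1 // {1}(divn_eq (phi a + phi b) p) addnC mulnC.
(* The upper digit of the product before reduction modulo [p]. *)
pose m := ((phi a + phi b) %/ p + phi a * psi b + (- f a)%R + (- f b)%R)%N.
have : (- f (a ** b))%R = m%:R :> 'Z_p.
  rewrite /m !natrD natrM !natr_Zp; have := fE a b; rewrite /bock /cup /delta1 => ->.
  by ring.
rewrite -[X in X = _ -> _]natr_Zp => /modp_eq e.
have e2 : (p * (- f (a ** b))%R = p * m %[mod p ^ 2])%N.
  by rewrite -mulnn -!muln_modr e.
have -> : ((phi a + p * (- f a)%R) * (psi b * p).+1 + (phi b + p * (- f b)%R) =
  phi (a ** b) + p * m + p ^ 2 * ((- f a)%R * psi b))%N.
  transitivity ((phi a + phi b) + p * (phi a * psi b + (- f a)%R + (- f b)%R)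
     + p ^ 2 * ((- f a)%R * psi b))%N; first by rewrite -mulnn; ring.
  by rewrite phiE /m; ring.
by apply/eqP; rewrite [in RHS]addnC [(p ^ 2 * _)%N]mulnC modnMDl -modnDmr e2 modnDmr.
Qed.

(** The triple is read off from [rho g = y^j x^i]: [phi] and [- f] are the two base-[p] digits of
    [i], and [psi] is [j]. *)
Lemma splitting_of_modular_hom (rho : G -> 'Mod_(p ^ 3)) : cont_hom_fin rho ->
  exists phi psi f, splits_bock_cup phi psi f /\
    forall g, phi g = 0 -> psi g = 0 -> f g = 0 -> rho g = 1%g.
Proof.
move=> [rhoM crho].
have /choice[i /choice[j ij]] := gen_xy.
pose phi g : 'Z_p := (i (rho g))%:R; pose psi g : 'Z_p := (j (rho g))%:R.
pose f g : 'Z_p := - (i (rho g) %/ p)%:R.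
have cont_rho (F : 'Mod_(p ^ 3) -> 'Z_p) : cont1 (F \o rho).
  by move=> z; exact: (locally_constant_open _ _ _ crho (F @^-1` [set z])).
have ijM a b : i (rho (a ** b)) =
      ((i (rho a) * (j (rho b) * p).+1 + i (rho b)) %% p ^ 2)%N /\
    j (rho (a ** b)) = j (rho a) + j (rho b) %[mod p].
  have [lti _ e] := ij (rho (a ** b)); have [_ _ ea] := ij (rho a).
  have [_ _ eb] := ij (rho b).
  have := rhoM a b; rewrite {1}e {1}ea {1}eb mul_xy => /inj_xy[ei ej].
  by split=> //; rewrite -ei modn_small.
have psiM : {morph psi : a b / a ** b >-> a + b}.
  by move=> a b; rewrite /psi -natrD; apply/modp_eq; case: (ijM a b).
have phiM : {morph phi : a b / a ** b >-> a + b}.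
  move=> a b; rewrite /phi -natrD; apply/modp_eq; case: (ijM a b) => -> _.
  rewrite modn_dvdm ?dvdn_exp // mulnS mulnA addnAC.
  by rewrite addnC modnMDl.
exists phi, psi, f; split; last first.
  move=> g phi0 psi0 f0; have [lti ltj ->] := ij (rho g).
  have /modp_eq : (j (rho g))%:R = 0%:R :> 'Z_p by exact: psi0.
  have /modp_eq : (i (rho g))%:R = 0%:R :> 'Z_p by exact: phi0.
  have /modp_eq : (i (rho g) %/ p)%:R = 0%:R :> 'Z_p by apply: oppr_inj; rewrite oppr0.
  rewrite !mod0n [(j _ %% _)%N]modn_small // [(_ %/ _ %% _)%N]modn_small; last first.
    by rewrite ltn_divLR ?prime_gt0 // mulnn.
  by move=> e1 e2 ->; rewrite (divn_eq (i (rho g)) p) e1 e2 mulg1.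
have cphi : cont1 phi := cont_rho (fun m => (i m)%:R).
have cpsi : cont1 psi := cont_rho (fun m => (j m)%:R).
have cf : cont1 f := cont_rho (fun m => - (i m %/ p)%:R).
split; [exact: H1_quot_hom cphi phiM|exact: H1_quot_hom cpsi psiM|exact: cf|].
move=> a b; rewrite /bock /cup /delta1 /f opprK.
(* Upper digit of the product: upper digits, carry of the lower digits, and the twist by [y]. *)
have -> : (i (rho (a ** b)) %/ p = (i (rho a) %/ p + i (rho b) %/ p
    + (i (rho a) %% p + i (rho b) %% p) %/ p + i (rho a) * j (rho b)) %% p)%N.
  case: (ijM a b) => -> _; rewrite -mulnn -modn_divl; congr (_ %% _)%N.
  rewrite mulnS mulnA addnAC addnC divnMDl ?prime_gt0 // addnC; congr (_ + _)%N.
  rewrite {1}(divn_eq (i (rho a)) p) {1}(divn_eq (i (rho b)) p) addnACA -mulnDl.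
  by rewrite divnMDl ?prime_gt0.
rewrite [in LHS]/phi [in LHS]/psi !val_Zp_nat ?prime_gt1 // Zp_nat_mod ?prime_gt1 //.
by rewrite !natrD natrM; ring.
Qed.

End ModularHom.

(** * Common kernels and the span of Bockstein-cup elements *)

Lemma compact_cover_compact (G : ProfiniteGroup) (A : set G) :
  compact A -> cover_compact A.
Proof.
(* The same space, with the identity as the base point for [compact_cover]. *)
pose Gp : ptopologicalType := HB.pack (Topological.sort (pg_sort G))
  (isPointed.Build (Topological.sort (pg_sort G)) pg_one).
by rewrite -[cover_compact A]/(@cover_compact Gp A) -compact_cover.
Qed.

Section Kernels.
Local Open Scope ring_scope.
Variables (G : ProfiniteGroup) (p : nat).
Hypothesis p_pr : prime p.

Lemma H1_quot_zero : @H1_quot G p (fun=> 0).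
Proof.
by split; [apply/locally_constantP => a; exact: nearW|split=> // a b; rewrite addr0].
Qed.

(** These triples give the homomorphisms [y^psi], which force the common kernel into [lpc G p 2]. *)
Lemma splits_bock_cup_zero (psi : G -> 'Z_p) : H1_quot psi ->
  splits_bock_cup _ _ (fun=> 0) psi (fun=> 0).
Proof.
have H0 := H1_quot_zero; move=> Hpsi; split=> // [|a b]; first exact: H0.1.
by rewrite /bock /cup /delta1 (_ : nat_of_ord 0 = 0%N) // addn0 div0n mul0r subrr addr0.
Qed.

(** On [lpc G p 2] both [phi] and [psi] vanish, so the homomorphism of a triple takes the value
    [x^(- p f)], trivial exactly when [f] is zero because [x] has order [p^2]. *)
Lemma T_of_mod_p3P g : T_of 'Mod_(p ^ 3) G g <->
  lpc G p 2 g /\ forall phi psi f, splits_bock_cup G p phi psi f -> f g = 0.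
Proof.
have [x [y [[ox oy] conj_xy gen_xy inj_xy]]] := mod_p3_generators p p_pr.
split=> [Tg|[Pg fg] rho crho]; last first.
  have [phi [psi [f [fE]]]] :=
    splitting_of_modular_hom _ _ p_pr _ _ conj_xy gen_xy inj_xy _ crho.
  have [[cphi [_ phiM]] [cpsi [_ psiM]] _ _] := fE.
  by apply; [exact: hom_lpc2 cphi phiM Pg|exact: hom_lpc2 cpsi psiM Pg|exact: fg fE].
have Tg0 phi psi f : splits_bock_cup G p phi psi f ->
    (phi g + p * (- f g)%R)%N = 0 %[mod p ^ 2] /\ psi g = 0 %[mod p].
  move=> /(modular_hom_of_splitting _ _ p_pr _ _ ox oy conj_xy) /Tg e.
  by apply: (inj_xy _ _ 0%N 0%N); rewrite !expg0 mulg1.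
have Pg : lpc G p 2 g.
  apply: contrapT => nPg; have [psi [cpsi psiM _]] := lpc_separation _ _ 0 _ p_pr I nPg.
  have Hpsi : H1_quot psi by apply: (H1_quot_hom _ _ p_pr _ cpsi) => a b; exact: psiM.
  have [_ /modp_eq] := Tg0 _ _ _ (splits_bock_cup_zero _ Hpsi).
  by rewrite natr_Zp => ->; rewrite ?eqxx.
split=> // phi psi f fE; have [[cphi [_ phiM]] _ _ _] := fE.
have [e _] := Tg0 _ _ _ fE; have : (p ^ 2 %| phi g + p * (- f g)%R)%N.
  by rewrite /dvdn e mod0n.
rewrite (hom_lpc2 _ _ p_pr _ _ cphi phiM Pg) (_ : nat_of_ord 0 = 0%N) // add0n.
rewrite -mulnn dvdn_pmul2l ?prime_gt0 // => pf.
have /modp_eq : (- f g)%R = 0 %[mod p] by rewrite mod0n; exact/eqP.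
by move=> /(_ p_pr); rewrite natr_Zp => e0; apply: oppr_inj; rewrite oppr0.
Qed.

(** Compose a homomorphism to Z/p^2 with the embedding sending [a] to [x^a]. *)
Lemma T_of_mod_p3_sub : T_of 'Mod_(p ^ 3) G `<=` T_of 'Z_(p ^ 2) G.
Proof.
move=> g Tg rho [rhoM crho].
have [x [_ [[ox _] _ _ _]]] := mod_p3_generators p p_pr.
have p2_gt1 : (1 < p ^ 2)%N by rewrite -{1}(exp1n 2) ltn_exp2r ?prime_gt1.
have hom_x : cont_hom_fin (fun a => x ^+ (rho a : 'Z_(p ^ 2)))%g.
  split=> [a b|]; last first.
    move=> z; exact: (locally_constant_open _ _ _ crho [set u | x ^+ (u : nat) = z]%g).
  rewrite -expgD; apply/eqP; rewrite eq_expg_mod_order ox rhoM /=.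
  by rewrite [X in ((_ %% X) %% _)%N]Zp_cast // modn_mod.
have := Tg _ hom_x; rewrite -(expg0 x) => /eqP; rewrite eq_expg_mod_order ox mod0n.
rewrite modn_small => [/eqP e|]; first exact: val_inj.
by rewrite -[X in (_ < X)%N](Zp_cast p2_gt1).
Qed.

Lemma lpc3_sub_T_of : lpc G p 3 `<=` T_of 'Mod_(p ^ 3) G.
Proof.
move=> g Hg; apply/T_of_mod_p3P; split; first exact: lpc_sub.
move=> phi psi f fE; rewrite -(splits_bock_cup1 _ _ p_pr _ _ _ fE).
have [Hphi Hpsi cf cE] := fE.
by apply: (infl2_delta1_lpc3 _ _ p_pr _ f g (bock_cup_infl2 _ _ _ _ Hphi Hpsi)).
Qed.

Lemma B2_quot_sumP (n : nat) (a : 'I_n -> 'Z_p) (c : G -> G -> 'Z_p)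
    (e : 'I_n -> G -> G -> 'Z_p) (f : G -> 'Z_p) (h : 'I_n -> G -> 'Z_p) :
  infl2 c -> cont1 f -> (forall x y, c x y = delta1 f x y) ->
  (forall i, infl2 (e i)) -> (forall i, cont1 (h i)) ->
  (forall i x y, e i x y = delta1 (h i) x y) ->
  B2_quot (fun x y => c x y - \sum_(i < n) a i * e i x y) <->
  forall u, lpc G p 2 u -> f u - \sum_(i < n) a i * h i u =
    f pg_one - \sum_(i < n) a i * h i pg_one.
Proof.
move=> ic cf cE ie ch eE.
apply: (B2_quotP _ _ p_pr _ (fun x => f x - \sum_(i < n) a i * h i x)).
- move=> x y u v Pu Pv; rewrite ic //; congr (_ - _); apply: eq_bigr => i _.
  by rewrite ie.
- apply/locally_constantP => x; move/locally_constantP: cf => /(_ x) cf.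
  have nh : \forall y \near x, forall i, h i y = h i x.
    by apply: filter_forall => i; move/locally_constantP: (ch i); exact.
  apply: filterS2 cf nh => y fy hy; rewrite fy; congr (_ - _).
  by apply: eq_bigr => i _; rewrite hy.
- move=> x y; have -> : \sum_(i < n) a i * e i x y = \sum_(i < n) a i * h i y -
      \sum_(i < n) a i * h i (x ** y) + \sum_(i < n) a i * h i x.
    rewrite -sumrB -big_split /=; apply: eq_bigr => i _.
    by rewrite eE /delta1; ring.
  by rewrite cE /delta1; ring.
Qed.

(** If [g] were outside [lpc G p 3], a separating cochain [f] would give a class [delta1 f] in the
    kernel of inflation. Writing it through Bockstein-cup elements, whose cochains [h i] do not
    distinguish [g] from 1, yields [f g = f 1 = 0]. *)
Lemma kernel_condition_T_of : bockstein_cup_kernel_condition G p ->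
  T_of 'Mod_(p ^ 3) G `<=` lpc G p 3.
Proof.
move=> kc g /T_of_mod_p3P[Pg Tg]; apply: contrapT => nHg.
have [f [cf fD fH fg]] := lpc_separation _ _ 1 _ p_pr Pg nHg.
have [P1 [PM PV]] := lpc_subgroup G p 2.
have ic : infl2 (delta1 f).
  move=> a b u v Pu Pv; rewrite /delta1.
  (* Moving [u] past [b] costs a commutator in [lpc G p 3], where [f] vanishes. *)
  have -> : a ** u ** (b ** v) = (a ** b) ** (u ** (pg_comm u b ** v)).
    by rewrite /pg_comm !pgE.
  have Hc : lpc G p 3 (pg_comm u b).
    have [_ [_ HV]] := lpc_subgroup G p 3.
    have -> : pg_comm u b = pg_inv (pg_comm b u) by rewrite /pg_comm !pgE.
    by apply: HV; exact: lpc_comm.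
  have Pc := lpc_sub _ _ _ _ Hc; have Pcv := PM _ _ Pc Pv.
  rewrite (fD _ _ (PM _ _ Pu Pcv)) (fD _ _ Pcv) (fD (pg_comm u b) _ Pv) (fD a _ Pu) (fD b _ Pv).
  by rewrite (fH _ Hc); ring.
have [n [e [a [eP BS]]]] := kc _ (ker_inf_delta1 _ _ _ f cf ic (fun _ _ => erefl)).
have /choice[h hP] : forall i, exists h, [/\ cont1 h, h g = h pg_one &
    forall x y, e i x y = delta1 h x y].
  move=> i; have [[_ [h [ch hE]]] [phi [psi [Hphi [Hpsi eE]]]]] := eP i.
  have hS : splits_bock_cup G p phi psi h by split=> // x y; rewrite -eE hE.
  by exists h; rewrite (Tg _ _ _ hS) (splits_bock_cup1 _ _ p_pr _ _ _ hS).
have f1 : f pg_one = 0 by apply: fH; exact: (lpc_subgroup G p 3).1.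
have ie i : infl2 (e i) by have [[[_ []]]] := eP i.
have ch i : cont1 (h i) by have [] := hP i.
have eE i x y : e i x y = delta1 (h i) x y by have [_ _ ->] := hP i.
have := (B2_quot_sumP _ a _ e f h ic cf (fun _ _ => erefl) ie ch eE).1 BS g Pg.
have -> : \sum_(i < n) a i * h i g = \sum_(i < n) a i * h i pg_one.
  by apply: eq_bigr => i _; have [_ -> _] := hP i.
by move/addIr; rewrite f1; apply/eqP.
Qed.

(** A point of [lpc G p 2] where [f] differs from [f 1] is outside [lpc G p 3], so some splitting
    triple detects it. By compactness finitely many triples detect all such points, and linear
    algebra expresses [f - f 1] through them. *)
Lemma T_of_kernel_condition : T_of 'Mod_(p ^ 3) G `<=` lpc G p 3 ->
  bockstein_cup_kernel_condition G p.
Proof.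
move=> TH c [[_ [ic _]] [f [cf cE]]].
have sP := lpc_subgroup G p 2; have [P1 _] := sP.
pose bad := [set u | lpc G p 2 u /\ f u != f pg_one].
(* Points outside [bad] receive the zero triple by default. *)
have /choice[s sP'] : forall u, exists s : (G -> 'Z_p) * (G -> 'Z_p) * (G -> 'Z_p),
    splits_bock_cup G p s.1.1 s.1.2 s.2 /\ (bad u -> s.2 u != 0).
  move=> u; have [[Pu fu]|nbad] := pselect (bad u); last first.
    exists (fun=> 0, fun=> 0, fun=> 0); split=> //=.
    exact: splits_bock_cup_zero H1_quot_zero.
  apply: contrapT => nos; move/eqP: fu; apply.
  apply: (infl2_delta1_lpc3 _ _ p_pr _ _ _ ic cf cE); apply: TH.
  apply/T_of_mod_p3P; split=> // phi psi h hS; apply: contrapT => /eqP hu.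
  by apply: nos; exists (phi, psi, h).
have cbad : compact bad.
  apply: (subclosed_compact _ (@pg_compact G)) => //; apply: closedI.
    exact: lpc_closed.
  exact: (locally_constant_closed _ _ _ cf (fun z => z != f pg_one)).
have {}cbad := compact_cover_compact _ _ cbad.
(* The open sets where a chosen third component is nonzero cover [bad]; [D] indexes a finite
   subcover. *)
have [||D _ Dcov] := cbad G setT (fun u => (s u).2 @^-1` [set z | z != 0]).
- by move=> u _; have [[_ _ cs _] _] := sP' u; exact: (locally_constant_open _ _ _ cs).
- by move=> u bu; exists u => //=; have [_] := sP' u; exact.
pose l : seq G := finmap.enum_fset D; pose t (i : 'I_(size l)) := s (tnth (in_tuple l) i).
have tS i : splits_bock_cup G p (t i).1.1 (t i).1.2 (t i).2 by have [] := sP' (tnth (in_tuple l) i).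
have t1 i : (t i).2 pg_one = 0 := splits_bock_cup1 _ _ p_pr _ _ _ (tS i).
pose e i x y := bock (t i).1.1 x y + cup (t i).1.1 (t i).1.2 x y.
have ie i : infl2 (e i) by have [? ? _ _] := tS i; exact: bock_cup_infl2.
have [i x y Px Py|x y Px Py|u Pu eu|a fa] :=
  linear_combination_of_ker _ _ p_pr _ _ (fun i => (t i).2) (fun u => f u - f pg_one) sP.
- have [_ _ _ tE] := tS i.
  by rewrite (infl2_delta1 _ _ _ _ _ _ (ie i) tE Py) t1 subr0.
- by rewrite (infl2_delta1 _ _ _ _ _ _ ic cE Py) addrAC.
- apply/eqP; rewrite subr_eq0; apply: contrapT => /negP fu.
  have [v /= vD /eqP] := Dcov u (conj Pu fu); apply.
  have vl : v \in l by [].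
  have vi : (index v l < size l)%N by rewrite index_mem.
  by have := eu (Ordinal vi); rewrite /t (tnth_nth pg_one) /= nth_index.
exists (size l), e, a; split=> [i|].
  split; first exact: splits_bock_cup_ker_inf (tS i).
  by have [? ? _ _] := tS i; exists (t i).1.1, (t i).1.2.
apply/(B2_quot_sumP _ _ _ _ f (fun i => (t i).2)) => //.
- by move=> i; have [] := tS i.
- by move=> i; have [] := tS i.
- move=> u Pu; rewrite -fa // subKr big1 ?subr0 // => i _.
  by rewrite t1 mulr0.
Qed.

End Kernels.

Theorem theorem11p4 (p : nat) (S G : ProfiniteGroup) (pi : S -> G) :
  prime p -> 2 < p ->
  is_free_profinite S ->
  cont_hom pi -> (forall g : G, exists s : S, pi s = g) ->
  [set s : S | pi s = pg_one] `<=` lpc S p 2 ->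
  (T_of 'Z_(p ^ 2) G `&` T_of 'Mod_(p ^ 3) G = lpc G p 3
   <-> bockstein_cup_kernel_condition G p).
Proof.
move=> p_pr _ _ _ _ _.
have -> : T_of 'Z_(p ^ 2) G `&` T_of 'Mod_(p ^ 3) G = T_of 'Mod_(p ^ 3) G.
  by apply/setIidPr; exact: T_of_mod_p3_sub.
split=> [TH|kc]; first by apply: T_of_kernel_condition p_pr _; rewrite TH.
by apply/seteqP; split; [exact: kernel_condition_T_of|exact: lpc3_sub_T_of].
Qed.
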